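(* For any partition $\mu$, $$\tilde H_\mu(x;1,t)=\sum_{T\in \mathcal{SSCT}(\cdot,\mu)} t^{\mathrm{cocharge}(T)}\, s_{\mathrm{shape}(T)}(x),$$ where $\mathcal{SSCT}(\cdot,\mu)$ is the set of colored tabloids $T$ of weight $\mu$ (rows increasing from left to right in prismatic order), of arbitrary partition shape, such that the colored letters increase up the columns of $T$ with respect to the co-prismatic order $<'$, and $\tilde H_\mu(x;q,t)$ is the modified Macdonald polynomial.
   Context: For a partition $\mu$, $\mu'_c=\#\{r:\mu_r\ge c\}$. The shape of $\mu$ is the set of cells $(r,c)$, $1\le c\le\mu_r$, with row $r$ counted upward from the bottom and column $c$ from left to right. $s_\lambda$ is the Schur function. Modified Macdonald polynomial. A filling $F$ of shape $\mu$ assigns a positive integer $F_{(r,c)}$ to each cell; $\mathrm{weight}(F)_i$ is the number of $i$'s in $F$. $\mathrm{maj}(F)=\sum(\mu'_c-r+1)$ over cells $(r,c)$, $r\ge2$, with $F_{(r,c)}>F_{(r-1,c)}$. An inversion triple consists of two cells $(i,c),(i,c')$, $c<c'$, with $u=F_{(i,c)}$, $w=F_{(i,c')}$, $v=F_{(i-1,c)}$ ($v=0$ if $i=1$), such that $u=v\ne w$, or $u>w>v$, or $w>v>u$, or $v>u>w$; $\mathrm{inv}(F)$ counts them. $\tilde H_\mu(x;q,t)=\sum_F q^{\mathrm{inv}(F)}t^{\mathrm{maj}(F)}x^{\mathrm{weight}(F)}$ over all fillings of shape $\mu$. Colored letters $x_y$ are positive integers $x$ (letters) with positive integer subscripts $y$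 (colors). Prismatic order: $u_v>r_c$ iff $r<u$, or $r=u$ and $c>v$. Co-prismatic order: $x_y>'u_v$ iff $y>v$, or $y=v$ and $x>u$. A colored tabloid of weight $\mu$ and shape $\gamma$ is a filling of the shape $\gamma$ (with $\gamma_r$ left-justified cells in row $r$) by the colored letters $x_y$, $1\le y\le\mu_x$, each used exactly once, with the entries of each row increasing from left to right in prismatic order. Cocharge. Given a colored tabloid $T$ of weight $\mu$, place its entries on a circle clockwise from a marked point $\star$: first the entries of row 1 in decreasing prismatic order, then those of row 2 in decreasing prismatic order, and so on. For each color $i$, consider only the entries of color $i$, whose letters are $1,\dots,\mu'_i$: label letter $1$ with $0$; label letter $a$ with the label of $a-1$ if $\star$ is passed when reading clockwise from $a-1$ to $a$, and with the label of $a-1$ plus $1$ otherwise. $\mathrm{cocharge}(T)$ is the sum of all labels over all colors $i=1,\dots,\mu_1$.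
   Formalization: The columns of T are formed after each row's entries are rearranged in co-prismatic order; with columns read from the prismatically ordered rows the identity fails, e.g. for μ=(3), where s_21 must have coefficient 2 but only one tabloid of shape (2,1) remains. *)

(* Defs.v *)
From mathcomp Require Import all_boot all_order all_algebra.
From mathcomp Require Import all_classical.

Set Implicit Arguments.
Unset Strict Implicit.
Unset Printing Implicit Defensive.

Import GRing.Theory.

Definition is_part (mu : seq nat) : bool := sorted geq mu && (0 \notin mu).

Definition part (mu : seq nat) (r : nat) : nat :=
  if r is r'.+1 then nth 0 mu r' else 0.

Definition conj_part (mu : seq nat) (c : nat) : nat := count (leq c) mu.

(* A filling is the list of its rows, bottom row first, each row read from left
   to right; its shape is then the library's [shape].  Rows and columns are
   numbered from 1.  Off the shape, in particular in row 0, the entry is 0. *)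
Definition entry (F : seq (seq nat)) (r c : nat) : nat :=
  if (r, c) is (r'.+1, c'.+1) then nth 0 (nth [::] F r') c' else 0.

Definition is_filling (mu : seq nat) (F : seq (seq nat)) : bool :=
  (shape F == mu) && all (fun k => 0 < k) (flatten F).

Definition weight (F : seq (seq nat)) (i : nat) : nat :=
  count_mem i (flatten F).

Definition maj (mu : seq nat) (F : seq (seq nat)) : nat :=
  \sum_(2 <= r < (size mu).+1)
    \sum_(1 <= c < (part mu r).+1 | entry F r.-1 c < entry F r c)
      (conj_part mu c - r + 1).

Definition is_inversion (u v w : nat) : bool :=
  [|| (u == v) && (v != w), (u > w) && (w > v),
      (w > v) && (v > u) | (v > u) && (u > w)].

(* For i = 1 the entry below is entry F 0 c = 0, as the convention requires. *)
Definition inv (mu : seq nat) (F : seq (seq nat)) : nat :=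
  \sum_(1 <= i < (size mu).+1)
    \sum_(1 <= c < (part mu i).+1)
      \sum_(c.+1 <= c' < (part mu i).+1)
        is_inversion (entry F i c) (entry F i.-1 c) (entry F i c').

(* A formal power series in the variables x_1, x_2, ... is given by its
   coefficients, an exponent vector being a function of the variable index.
   The sums over sets below run over finite sets: a prescribed weight bounds
   the entries, and a prescribed content leaves finitely many tabloids. *)
Definition power_series (R : Type) : Type := (nat -> nat) -> R.

(* Coefficients in Z[t][q]: the outer indeterminate is q, the inner one t. *)
Definition modified_macdonald (mu : seq nat) :
    power_series {poly {poly int}} :=
  fun alpha =>
    (\sum_(F \in [set F | is_filling mu F /\ weight F = alpha]%classic)
       ('X^(inv mu F) * ('X^(maj mu F))%:P : {poly {poly int}}))%R.

(* Entries compared along a column are those that zip pairs up; each row is at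
   least as long as the next one, so no cell with a cell above it is lost. *)
Definition increasing_columns (A : Type) (lt : rel A) (T : seq (seq A)) : bool :=
  sorted (fun row row' => all (fun p => lt p.1 p.2) (zip row row')) T.

Definition is_ssyt (la : seq nat) (T : seq (seq nat)) : bool :=
  [&& is_filling la T, all (sorted leq) T & increasing_columns ltn T].

Definition schur (la : seq nat) : power_series int :=
  fun alpha =>
    (\sum_(T \in [set T | is_ssyt la T /\ weight T = alpha]%classic) (1 : int))%R.

(* x_y is the pair (x, y) of its letter x and its color y. *)
Notation colored_letter := (nat * nat)%type.

Definition prism_lt (a b : colored_letter) : bool :=
  (a.1 < b.1) || (a.1 == b.1) && (b.2 < a.2).

Definition coprism_lt (a b : colored_letter) : bool :=
  (a.2 < b.2) || (a.2 == b.2) && (a.1 < b.1).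

Definition coprism_le (a b : colored_letter) : bool :=
  (a == b) || coprism_lt a b.

Definition colored_letters (mu : seq nat) : seq colored_letter :=
  [seq (x, y) | x <- iota 1 (size mu), y <- iota 1 (part mu x)].

Definition is_colored_tabloid (mu : seq nat) (T : seq (seq colored_letter)) :
    bool :=
  perm_eq (flatten T) (colored_letters mu) && all (sorted prism_lt) T.

(* A tabloid is determined by the sets of entries of its rows.  Its rows are
   listed in prismatic order; its columns, which are compared in co-prismatic
   order, are formed after the entries of each row are put in that same order.
   Forming them from the prismatically ordered rows instead would make the
   Schur expansion fail already for mu = (3): there x_1 x_2 x_3 has coefficient
   6 in the modified Macdonald polynomial, but only one tabloid of shape (2, 1)
   would remain and the expansion would give 4. *)
Definition is_ssct (mu : seq nat) (T : seq (seq colored_letter)) : bool :=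
  [&& is_colored_tabloid mu T, is_part (shape T)
    & increasing_columns coprism_lt (map (sort coprism_le) T)].

(* The circle, read clockwise from the marked point; the rows of a tabloid are
   increasing, so reversing them lists them in decreasing order. *)
Definition circle (T : seq (seq colored_letter)) : seq colored_letter :=
  flatten (map rev T).

Definition passes_star (T : seq (seq colored_letter)) (a b : colored_letter) :
    bool :=
  index b (circle T) < index a (circle T).

Fixpoint label (T : seq (seq colored_letter)) (i a : nat) {struct a} : nat :=
  match a with
  | 0 | 1 => 0
  | a'.+1 => if passes_star T (a', i) (a'.+1, i) then label T i a'
             else (label T i a').+1
  end.

Definition cocharge (mu : seq nat) (T : seq (seq colored_letter)) : nat :=
  \sum_(1 <= i < (part mu 1).+1)
    \sum_(1 <= a < (conj_part mu i).+1) label T i a.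

(* Main.v *)
Require Import Defs.
From mathcomp Require Import all_boot all_order all_algebra.
From mathcomp Require Import all_classical.
From mathcomp Require Import zify.

Set Implicit Arguments.
Unset Strict Implicit.
Unset Printing Implicit Defensive.

(** Ordering the cells column by column, a filling of [mu] becomes a word, and
    a semistandard colored tabloid becomes a standard tableau on the colored
    letters in co-prismatic order.  Robinson-Schensted-Knuth by column insertion
    sends a word to a pair of a semistandard and a standard tableau of the same
    shape, and [w_i < w_(i+1)] exactly when the cell [i + 1] of the standard
    tableau lies in a higher row than the cell [i].  Both [maj] and [cocharge]
    are the same weighted sum over these ascents inside the columns of [mu], so
    they agree; summing over the semistandard tableau gives the Schur function.
    Column insertion is carried out on Gelfand-Tsetlin patterns, where each step
    only compares two interlacing partitions. *)

(** * Column insertion on Gelfand-Tsetlin patterns *)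

Definition add_cell (la : nat -> nat) (s k : nat) : nat := la k + (k == s).
Definition del_cell (la : nat -> nat) (s k : nat) : nat := la k - (k == s).

Definition interlace (rho la : nat -> nat) : Prop :=
  forall k, la k.+1 <= rho k <= la k.

(* One level of the column insertion of a letter: [rho] and [la] are the shapes
   of the entries below and up to [y], and [rho] gains a cell in row [r] (no cell
   if [r] is past its last row); then [la] gains a cell in row [up la rho r], the
   highest row at most [r] that keeps [la / rho] a horizontal strip.  The reverse
   step is [down], where the row [n] means that no cell is removed. *)
Fixpoint up (la rho : nat -> nat) (r : nat) : nat :=
  if r is r'.+1 then if la r < rho r' then r else up la rho r' else 0.

Definition down (nu rho : nat -> nat) (n s : nat) : nat :=
  s + find (fun r => nu r.+1 < rho r) (iota s (n - s)).

Lemma upP la rho r (s := up la rho r) :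
  [/\ s <= r, s = 0 \/ la s < rho s.-1
    & forall k, s <= k < r -> rho k <= la k.+1].
Proof.
rewrite /s {s}; elim: r => [|r [le1 lt1 max1]] /=; first by split=> //; left.
case: ifP => h; first by split=> //; [right | move=> k; lia].
split=> //; first lia.
by move=> k hk; case: (ltngtP k r) => [?|?|->]; [apply: max1; lia | lia | lia].
Qed.

(** The conditions of [upP] have one solution: of two candidates, the higher one stops at a row that
    the lower one declares blocked. *)
Lemma up_eq la rho r s :
  s <= r -> s = 0 \/ la s < rho s.-1 ->
  (forall k, s <= k < r -> rho k <= la k.+1) -> up la rho r = s.
Proof.
move=> ler ads maxs; have [] := upP la rho r.
set s' := up _ _ _ => ler' ads' maxs'.
case: (ltngtP s' s) => // h.
  by case: ads => ?; [lia|]; have := maxs' s.-1; rewrite prednK; lia.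
by case: ads' => ?; [lia|]; have := maxs s'.-1; rewrite prednK; lia.
Qed.

Lemma downP nu rho n s (r := down nu rho n s) : s <= n ->
  [/\ s <= r <= n, r < n -> nu r.+1 < rho r
    & forall k, s <= k < r -> rho k <= nu k.+1].
Proof.
move=> sn; rewrite /r /down {r}; set f := find _ _.
have fle : f <= n - s by rewrite -[X in _ <= X](size_iota s) find_size.
split; first lia.
  move=> h; have : has (fun r => nu r.+1 < rho r) (iota s (n - s)).
    by rewrite has_find size_iota -/f; lia.
  by move/(nth_find 0); rewrite -/f nth_iota //; lia.
move=> k hk; have := @before_find _ 0 (fun r => nu r.+1 < rho r)
  (iota s (n - s)) (k - s).
rewrite -/f => /(_ ltac:(lia)); rewrite nth_iota; last lia.
by rewrite subnKC; lia.
Qed.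

Lemma down_eq nu rho n s r :
  s <= r <= n -> (r < n -> nu r.+1 < rho r) ->
  (forall k, s <= k < r -> rho k <= nu k.+1) -> down nu rho n s = r.
Proof.
move=> ler adr minr; have [|] := @downP nu rho n s; first lia.
set r' := down _ _ _ _ => ler' adr' minr'.
case: (ltngtP r' r) => // h; last by have := minr' r; lia.
by have := minr r'; lia.
Qed.

(** Invertibility of one level. The rows skipped on the way from [r] down to [s] stay blocked after
    both cells are added, while the new cell of [rho] unblocks row [r], so the search of [down]
    stops there. The value [r = n] encodes that [rho] is unchanged. *)
Lemma step_up n rho la r (rho' := if r < n then add_cell rho r else rho)
    (s := up la rho r) :
  interlace rho la -> (forall k, n <= k -> rho k = 0) -> r <= n ->
  (r < n -> r = 0 \/ rho r < rho r.-1) ->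
  [/\ s <= r, interlace rho' (add_cell la s), s = 0 \/ la s < la s.-1
    & down (add_cell la s) rho' n s = r].
Proof.
move=> il rho0 rn adr; have := upP la rho r; rewrite -/s => -[sr ads maxs].
(* When [s < r], the new cell of [rho] in row [r] still fits under [la]: [r] is addable to [rho] and
   was skipped by [up], so [rho r < rho r.-1 <= la r]. *)
have rle : r < n -> s < r -> rho r < la r.
  move=> ltrn sr'; case: adr => // [?|?]; first lia.
  have := maxs r.-1; rewrite prednK; lia.
have r0 : s = 0 \/ la s < la s.-1.
  by case: ads => ?; [left | right; have := il s.-1; lia].
split=> //.
  move=> k; have := il k; rewrite /rho' /add_cell.
  case: (eqVneq k.+1 s) => [e|_]; case: (eqVneq k s) => [e'|e']; try lia.
  - case: ads => [?|]; first lia.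
    by rewrite -e /=; case: (r < n); lia.
  - by move: maxs; rewrite e'; case: (r < n); case: (s == r); lia.
  - case: ltnP => ?; last lia.
    case: (eqVneq k r) => [e''|]; last lia.
    by have := rle; rewrite -e''; lia.
apply: down_eq; first lia.
  move=> rn'; rewrite /rho' rn' /add_cell eqxx; have := il r.
  case: eqP; lia.
move=> k hk; have := maxs k hk; rewrite /rho' /add_cell.
by case: (r < n); case: (k == r) (eqVneq k r) => [] []; lia.
Qed.

(** The mirror of [step_up]: the rows passed over by [down] are those that [up] skips on the way
    back, and removing the corner of [nu] reopens row [s]. *)
Lemma step_down n nu rho' s (r := down nu rho' n s)
    (rho := if r < n then del_cell rho' r else rho') :
  interlace rho' nu -> (forall k, n <= k -> rho' k = 0) -> s <= n ->
  nu s.+1 < nu s ->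
  [/\ s <= r <= n, interlace rho (del_cell nu s),
      r < n -> rho' r.+1 < rho' r & up (del_cell nu s) rho r = s].
Proof.
move=> il rho0 sn cor; have := downP nu rho' sn; rewrite -/r => -[srn adr minr].
split=> //.
- move=> k; have := il k; rewrite /rho /del_cell.
  case: (eqVneq k s) => [e|ne].
    have -> : (k.+1 == s) = false by lia.
    case: ltnP => rn; last first.
      have [e'|?] := eqVneq s r; last by have := minr s; rewrite e; lia.
      by have := rho0 s; rewrite e; lia.
    have [e'|?] := eqVneq k r; first by have := adr rn; rewrite -e'; lia.
    by have := minr k; rewrite e; lia.
  case: ltnP => rn; last by case: (k.+1 == s); lia.
  have [e'|?] := eqVneq k r; last by case: (k.+1 == s); lia.
  by have := adr rn; rewrite -e'; case: (k.+1 == s); lia.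
- by move=> rn; have := il r.+1; have := adr rn; lia.
apply: up_eq; first lia.
  have [->|s0] := posnP s; [by left | right].
  have := il s.-1; rewrite /rho /del_cell eqxx prednK //.
  have e : (s.-1 == r) = false by lia.
  by case: (ltnP r n) => _; rewrite ?e; lia.
move=> k hk; have := minr k hk; rewrite /rho /del_cell.
have -> : (k.+1 == s) = false by lia.
by case: ltnP => _; rewrite ?subn0 //; lia.
Qed.

(* A tableau with entries at most [m] is encoded by its Gelfand-Tsetlin pattern
   [:: la_m; ...; la_1], where [la_y] is the shape formed by the entries that
   are at most [y]. *)
Definition top (p : seq (nat -> nat)) : nat -> nat := head (fun=> 0) p.

Fixpoint is_pattern (p : seq (nat -> nat)) : Prop :=
  if p is la :: p' then interlace (top p') la /\ is_pattern p' else True.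

(* Column insertion of the letter [x]: it returns the new pattern and the row of
   the new cell, or [size p] if [x > size p], when nothing is inserted. *)
Fixpoint ins (x : nat) (p : seq (nat -> nat)) : seq (nat -> nat) * nat :=
  if p is la :: p' then
    if x <= size p then
      let s := up la (top p') (ins x p').2 in
      (add_cell la s :: (ins x p').1, s)
    else (p, size p)
  else (p, 0).

(** The inverse of [ins], returning the expelled letter. If no cell is removed, this letter is
    [(size p).+1], which one level up is the level where the insertion started. *)
Fixpoint del (s : nat) (p : seq (nat -> nat)) : seq (nat -> nat) * nat :=
  if p is nu :: p' then
    if s < size p then
      let r := down nu (top p') (size p') s in
      (del_cell nu s :: (del r p').1, (del r p').2)
    else (p, (size p).+1)
  else (p, 1).

Lemma pattern_top0 p k : is_pattern p -> size p <= k -> top p k = 0.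
Proof.
elim: p k => //= la p IH k [il pp] hk; case: k hk => // k hk.
by have := il k; rewrite IH //; lia.
Qed.

Lemma pattern_decr p k : is_pattern p -> top p k.+1 <= top p k.
Proof. by case: p => //= la p [/(_ k) ? _]; lia. Qed.

Lemma ins_big x p : size p < x -> ins x p = (p, size p).
Proof. by case: p => //= la p h; rewrite leqNgt h. Qed.

Lemma del_big s p : size p <= s -> del s p = (p, (size p).+1).
Proof. by case: p => //= la p h; rewrite ltnNge h. Qed.

Lemma size_ins x p : size (ins x p).1 = size p.
Proof. by elim: p => //= la p IH; case: ifP => //= _; rewrite IH. Qed.

Lemma size_del s p : size (del s p).1 = size p.
Proof. by elim: p s => //= la p IH s; case: ifP => //= _; rewrite IH. Qed.

Lemma ins_top x p : 0 < x <= size p ->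
  top (ins x p).1 = add_cell (top p) (ins x p).2.
Proof. by case: p => [|la p] /=; [lia | case: ifP => //; lia]. Qed.

(** The clauses form one induction: those on the row of the new cell are the hypotheses of [step_up]
    one level higher. The [minn] accounts for letters beyond the alphabet of a truncated pattern,
    which leave no trace and all come back as [(size p).+1]. *)
Lemma ins_spec x p (r := ins x p) : 0 < x -> is_pattern p ->
  [/\ is_pattern r.1, r.2 <= size p, (r.2 < size p) = (x <= size p),
      x <= size p -> r.2 = 0 \/ top p r.2 < top p r.2.-1
    & del r.2 r.1 = (p, minn x (size p).+1)].
Proof.
move=> x0; rewrite /r {r}; elim: p => [|la p IH] /=.
  by move=> _; split=> //; try lia; congr (_, _); lia.
move=> [il pp]; have [{}IH1 IH2 IH3 IH4 IH5] := IH pp.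
case: (leqP x (size p).+1) => h /=; last first.
  by split=> //=; rewrite ?ltnn; try lia; congr (_, _); lia.
set rho := top p; set r := (ins x p).2.
(* Below the level of [x] nothing is inserted and the row is [size p], the no-cell value of
   [step_up]. *)
have topE : top (ins x p).1 = if r < size p then add_cell rho r else rho.
  by rewrite /r IH3; case: leqP => h'; [apply: ins_top; rewrite x0 | rewrite ins_big].
have [k hk|||sr il' ads dn] := @step_up (size p) rho la r il.
- exact: pattern_top0.
- exact: IH2.
- by rewrite -/r IH3 => /IH4.
rewrite size_ins topE.
have -> : up la rho r < (size p).+1 by lia.
rewrite dn IH5; split=> //; try lia.
congr (_ :: _, _) => /=; last lia.
by apply/funext => k; rewrite /del_cell /add_cell addnK.
Qed.

Lemma del_spec s p (r := del s p) :
  is_pattern p -> (s < size p -> top p s.+1 < top p s) ->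
  [/\ is_pattern r.1, 0 < r.2 <= (size p).+1, (r.2 <= size p) = (s < size p),
      s < size p -> top r.1 = del_cell (top p) s
    & ins r.2 r.1 = (p, minn s (size p))].
Proof.
rewrite /r {r}; elim: p s => [|nu p IH] s /=.
  by move=> _ _; split=> //; congr (_, _); lia.
move=> [il pp]; case: (ltnP s (size p).+1) => h /= cor; last first.
  by split=> //; try lia; rewrite ltnn; congr (_, _); lia.
set rho := top p in il *; set r := down nu rho (size p) s.
have [k hk|||sr il' ads upE] := @step_down (size p) nu rho s il.
- exact: pattern_top0.
- by [].
- exact: cor.
rewrite -/r in sr il' ads upE.
have [IH1 IH2 IH3 IH4 IH5] := IH r pp ads.
have topE : top (del r p).1 = if r < size p then del_cell rho r else rho.
  by case: (ltnP r (size p)) => h'; [apply: IH4 | rewrite del_big].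
have hx : (del r p).2 <= (size p).+1 by lia.
rewrite size_del hx IH5 topE /=.
have -> : minn r (size p) = r by lia.
rewrite upE; split=> //; try lia.
congr (_ :: _, _).
apply/funext => k; rewrite /add_cell /del_cell.
by case: (eqVneq k s) => [->|]; have := cor isT; lia.
Qed.

(* Inserting [y] and then [x] creates a second cell strictly above the first one
   exactly when [y < x]. *)
Lemma ins_ins x y p : 0 < x -> 0 < y -> is_pattern p ->
  (x <= y -> (ins x (ins y p).1).2 <= (ins y p).2) /\
  (y < x -> y <= size p -> (ins y p).2 < (ins x (ins y p).1).2).
Proof.
move=> x0 y0; elim: p => [|la p IH] /=; first by split=> //; lia.
move=> [il pp]; have [IH1 IH2] := IH pp.
have [P1 le1 lt1 _ _] := ins_spec y0 pp.
case: (leqP y (size p).+1) => hy /=; last first.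
  have [_ ? _ _ _] := ins_spec x0 pp.
  have [? _ _] := upP la (top p) (ins x p).2.
  by split; [case: (leqP x (size p).+1) => //= | ]; lia.
rewrite size_ins; set s1 := up la _ _; case: (leqP x (size p).+1) => hx /=; last first.
  by have [? _ _] := upP la (top p) (ins y p).2; split; lia.
have [P2 le2 lt2 _ _] := ins_spec x0 P1; rewrite size_ins in le2 lt2.
have [s1r ads1 max1] := upP la (top p) (ins y p).2; rewrite -/s1 in s1r ads1 max1.
set r1 := (ins y p).2 in s1r max1 IH1 IH2 le1 lt1 *.
set r2 := (ins x (ins y p).1).2 in IH1 IH2 le2 lt2 *.
have [] := upP (add_cell la s1) (top (ins y p).1) r2.
set s2 := up _ _ _ => s2r ads2 max2.
split=> [xy|yx _].
  have r21 := IH1 xy; case: (leqP s2 s1) => // s12.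
  (* Here [s1 < s2 <= r1], so row [s2.-1] of the lower shape is unchanged, and the first insertion
     could already have stopped at [s2]. *)
  case: ads2; first lia.
  have -> : top (ins y p).1 s2.-1 = top p s2.-1.
    have [h|h] := leqP y (size p); last by rewrite ins_big.
    rewrite ins_top ?y0 // /add_cell -/r1; case: (eqVneq s2.-1 r1); lia.
  by have := max1 s2.-1; rewrite /add_cell prednK; lia.
have yp : y <= size p by lia.
have r12 := IH2 yx yp.
case: (leqP s2 s1) => // s21.
(* The cell gained in row [r1] one level below opens row [r1.+1], since [la r1.+1 <= top p r1]; the
   second insertion cannot pass below that row. *)
have := max2 r1; rewrite ins_top ?y0 // /add_cell -/r1 eqxx.
have -> : (r1.+1 == s1) = false by lia.
by have := il r1; lia.
Qed.

Lemma sum_add_cell M la s : s < M ->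
  \sum_(k < M) add_cell la s k = (\sum_(k < M) la k).+1.
Proof.
move=> sM; rewrite /add_cell big_split /= -addn1; congr (_ + _).
rewrite (bigD1 (Ordinal sM)) //= eqxx big1 // => i.
by rewrite -val_eqE /= => /negPf ->.
Qed.

(** The size of the strip [la_y / la_(y-1)], that is, the number of entries [y]; [M] is meant to
    bound the number of rows. *)
Fixpoint pweight (M : nat) (p : seq (nat -> nat)) (y : nat) : nat :=
  if p is la :: p' then
    if y == size p then \sum_(k < M) la k - \sum_(k < M) top p' k
    else pweight M p' y
  else 0.

Lemma ins_weight M x p y : 0 < x -> is_pattern p -> size p <= M ->
  pweight M (ins x p).1 y = pweight M p y + ((x == y) && (y <= size p)).
Proof.
move=> x0; elim: p => [|la p IH] /=; first by move=> *; case: (eqVneq x y); lia.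
move=> [il pp] pM; have {}IH := IH pp ltac:(lia).
have [P1 le1 lt1 _ _] := ins_spec x0 pp.
have le_sum : \sum_(k < M) top p k <= \sum_(k < M) la k.
  by apply: leq_sum => k _; have := il k; lia.
case: (leqP x (size p).+1) => hx /=; last by case: (eqVneq x y); lia.
rewrite size_ins; case: (eqVneq y (size p).+1) => [->|ny]; last first.
  by rewrite IH; case: (eqVneq x y) => // _; lia.
have [? _ _] := upP la (top p) (ins x p).2.
rewrite sum_add_cell; last lia.
case: (eqVneq x (size p).+1) => [->|nx].
  by rewrite ins_big //= ltnSn addn1 subSn.
by rewrite ins_top ?sum_add_cell ?subSS ?addn0 //; lia.
Qed.

(* A word [s_N :: ... :: s_1] encodes the standard tableau built by adding the
   [i]-th cell in row [s_i]. *)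
Fixpoint is_yam (j : seq nat) : bool :=
  if j is s :: j' then
    ((s == 0) || (count_mem s j' < count_mem s.-1 j')) && is_yam j'
  else true.

Lemma yam_decr j k : is_yam j -> count_mem k.+1 j <= count_mem k j.
Proof.
elim: j => //= t j IHj /andP[ht /IHj ?].
by case: (eqVneq t k.+1) ht => [->|?] /=; case: (eqVneq k.+1 k) => ?; lia.
Qed.

(** A cell in row [k] rests on earlier cells in all lower rows. *)
Lemma yam_lt j k : is_yam j -> k \in j -> k < size j.
Proof.
elim: j k => //= s j IH k /andP[hs yam]; rewrite inE => /predU1P[->|/(IH _ yam)]; last lia.
case/orP: hs => [/eqP -> //|hs].
have /(IH _ yam) : s.-1 \in j by rewrite -has_pred1 has_count; apply: leq_ltn_trans hs.
by lia.
Qed.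

(** The word is inserted from its right end, so the row of the most recent cell heads the second
    component, as [is_yam] expects. The constant zero shapes are the pattern of the empty
    tableau. *)
Fixpoint rsk (m : nat) (w : seq nat) : seq (nat -> nat) * seq nat :=
  if w is x :: w' then
    let r := ins x (rsk m w').1 in (r.1, r.2 :: (rsk m w').2)
  else (nseq m (fun=> 0), [::]).

Fixpoint unrsk (p : seq (nat -> nat)) (j : seq nat) : seq nat :=
  if j is s :: j' then
    let r := del s p in r.2 :: unrsk r.1 j'
  else [::].

(** The insertion tableau as a pattern and the recording tableau as a Yamanouchi word; the last
    clause says that their shapes agree. *)
Definition rsk_pair (m : nat) (p : seq (nat -> nat)) (j : seq nat) : Prop :=
  [/\ size p = m, is_pattern p, is_yam j & forall k, count_mem k j = top p k].

Lemma rskP m w : all (fun x => 0 < x <= m) w ->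
  rsk_pair m (rsk m w).1 (rsk m w).2 /\
  [/\ unrsk (rsk m w).1 (rsk m w).2 = w, size (rsk m w).2 = size w
    & forall y, pweight m (rsk m w).1 y = count_mem y w].
Proof.
elim: w => [_|x w IH] /=.
  split; last first.
    by split=> // y; elim: {2}m => //= n ->; rewrite big1 // sub0n if_same.
  by split=> //=; [rewrite size_nseq | elim: m => //= -[] | case: m].
move=> /andP[/andP[x0 xm]] /IH[[sz pat yam cnt] [unr szj wt]].
have [pat1 le1 lt1 ad dl] := ins_spec x0 pat; rewrite sz in le1 lt1 ad dl.
split; last split.
- split=> //=; first by rewrite size_ins.
    by rewrite yam andbT !cnt; case: (ad xm) => ->; rewrite ?eqxx ?orbT.
  by move=> k; rewrite ins_top ?sz ?x0 // /add_cell -cnt eq_sym addnC.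
- by rewrite dl /= (minn_idPl _) ?unr //; lia.
- by rewrite szj.
move=> y; rewrite ins_weight ?sz // wt addnC; congr (_ + _).
by case: eqP => //= <-; rewrite xm.
Qed.

(** With [rskP], which composes in the other order, this makes [rsk m] a bijection from the words
    over [1, ..., m] onto these pairs. *)
Lemma unrskP m p j : rsk_pair m p j ->
  [/\ size (unrsk p j) = size j, all (fun x => 0 < x <= m) (unrsk p j)
    & rsk m (unrsk p j) = (p, j)].
Proof.
elim: j p => [|s j IH] p [sz pat yam cnt] /=.
  split=> //; congr (_, _).
  elim: m p sz pat cnt {yam} => [|m IHm] [|la p] //= [sz] [il pat] cnt.
  have la0 : la = fun=> 0 by apply/funext => k; rewrite -cnt.
  rewrite la0; congr (_ :: _); apply: IHm => // k.
  by have := il k; rewrite la0 /=; lia.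
move: yam => /= /andP[hs yam].
have s_lt : s < size p.
  rewrite ltnNge; apply/negP => /(pattern_top0 pat).
  by rewrite -cnt /= eqxx.
(* Row [s] ends in a corner, because the word with its latest step dropped is still Yamanouchi. *)
have cor : top p s.+1 < top p s.
  rewrite -!cnt /= eqxx.
  have -> : (s == s.+1) = false by lia.
  by rewrite ltnS yam_decr.
have [pat1 x0 xs tp ins1] := del_spec pat (fun=> cor).
have [|szu al rs] := IH (del s p).1.
  split=> //; first by rewrite size_del.
  by move=> k; rewrite tp // /del_cell -cnt /= eq_sym; lia.
split; first by rewrite szu.
  by rewrite al andbT -sz xs s_lt; lia.
by rewrite rs /= ins1 (minn_idPl _) //; lia.
Qed.

(** Position [i.+1] is inserted just before position [i], so [ins_ins] compares the two new cells;
    later insertions only prepend to the recording word. *)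
Lemma rsk_ascent m w i : all (fun x => 0 < x <= m) w -> i.+1 < size w ->
  (nth 0 w i.+1 < nth 0 w i)
    = (nth 0 (rsk m w).2 i.+1 < nth 0 (rsk m w).2 i).
Proof.
elim: w i => //= x w IH [|i] /andP[hx hw] hi; last by rewrite IH.
case: w hw hi {IH} => //= y w /andP[hy hw] _.
have [[sz pat _ _] _] := rskP hw.
by have [] := @ins_ins x y _ _ _ pat; rewrite ?sz; lia.
Qed.

(** * Tableaux, patterns and Yamanouchi words *)

(** [P] is closed downward, so it holds exactly on a prefix of the sorted list. *)
Lemma sorted_count (T : eqType) (x0 : T) (le : rel T) (P : pred T) s i :
  transitive le -> (forall a b, le a b -> P b -> P a) -> sorted le s ->
  (i < count P s) = (i < size s) && P (nth x0 s i).
Proof.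
move=> tr dP; elim: s i => [|x s IH] i //= srt.
have {}IH := IH^~ (path_sorted srt).
case Px: (P x) => /=.
  by case: i => [|i] /=; rewrite ?add1n ?Px // !ltnS IH.
have nP : {in s, P =1 pred0}.
  move=> y ys; apply: contraFF Px; apply: dP.
  exact: (allP (order_path_min tr srt)).
rewrite (eq_in_count nP) count_pred0 /=.
case: i => [|i] /=; first by rewrite Px.
by rewrite ltnS; case: (ltnP i (size s)) => //= si; rewrite nP ?mem_nth.
Qed.

Lemma all_zipP (A B : Type) (a0 : A) (b0 : B) (P : pred (A * B)) s t :
  all P (zip s t) <->
  forall i, i < size s -> i < size t -> P (nth a0 s i, nth b0 t i).
Proof.
elim: s t => [|a s IH] [|b t] //=; split.
- by move=> /andP[Pab /IH Pst] [|i] //= ? ?; apply: Pst.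
- by move=> h; rewrite (h 0) //=; apply/IH => i ? ?; apply: (h i.+1).
Qed.

Section Columns.

Variables (T : eqType) (x0 : T) (le lt : rel T) (s s' : seq T).
Hypotheses (le_refl : reflexive le) (le_trans : transitive le)
  (ltE : forall a b, lt a b = ~~ le b a)
  (srt : sorted le s) (srt' : sorted le s').

(** Each entry of the upper row that is at most [b] sits on an entry strictly below [b]. Such counts
    are what interlacing and the Yamanouchi condition speak about, for integers and for colored
    letters alike. *)
Lemma columns_count b : size s' <= size s ->
  all (fun p => lt p.1 p.2) (zip s s') -> count (le^~ b) s' <= count (lt^~ b) s.
Proof.
move=> sz /(all_zipP x0 x0) /= lts; rewrite leqNgt; apply/negP => h.
have := h; rewrite (sorted_count x0 _ le_trans _ srt'); last first.
  by move=> a c /le_trans; apply.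
move=> /andP[is' leb]; have := ltnn (count (lt^~ b) s).
rewrite (sorted_count x0 _ le_trans _ srt); last first.
  by move=> a c ac; rewrite !ltE; apply: contra => /le_trans; apply.
rewrite (leq_trans is' sz) /= => /negP; apply.
have := lts _ (leq_trans is' sz) is'; rewrite !ltE; apply: contra.
exact: le_trans.
Qed.

(** Taking for [b] the entry at position [i] of the upper row forces more than [i] entries of the
    lower row to be smaller than it. *)
Lemma count_columns :
  (forall b, b \in s' -> count (le^~ b) s' <= count (lt^~ b) s) ->
  all (fun p => lt p.1 p.2) (zip s s').
Proof.
move=> h; apply/(all_zipP x0 x0) => i _ is'.
have : i < count (le^~ (nth x0 s' i)) s'.
  rewrite (sorted_count x0 _ le_trans _ srt') ?is' /= ?le_refl //.
  by move=> a c /le_trans; apply.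
move/leq_trans/(_ (h _ (mem_nth _ is'))).
rewrite (sorted_count x0 _ le_trans _ srt); first by case/andP.
by move=> a c ac; rewrite !ltE; apply: contra => /le_trans; apply.
Qed.

End Columns.

Lemma increasing_columnsP (A : Type) (lt : rel A) (T : seq (seq A)) :
  increasing_columns lt T <->
  forall k, all (fun p => lt p.1 p.2) (zip (nth [::] T k) (nth [::] T k.+1)).
Proof.
split=> [/(sortedP [::]) h k | h]; last by apply/(sortedP [::]) => k _.
case: (ltnP k.+1 (size T)) => [/h //|h'].
by rewrite (nth_default _ h'); case: (nth _ _ _).
Qed.

Section Rows.

Variable A : Type.
Implicit Type T : seq (seq A).

Lemma nth_shape T k : nth 0 (shape T) k = size (nth [::] T k).
Proof. by elim: T k => [|r T IH] [|k] //=. Qed.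

Lemma part_shapeP T : is_part (shape T) <->
  (forall k, k < size T -> 0 < size (nth [::] T k)) /\
  (forall k, size (nth [::] T k.+1) <= size (nth [::] T k)).
Proof.
split=> [/andP[/(sortedP 0) srt n0]|[h0 h1]].
  split=> [k kT|k].
    rewrite lt0n -nth_shape; apply: contraNneq n0 => <-.
    by rewrite mem_nth ?size_map.
  rewrite -!nth_shape; case: (ltnP k.+1 (size T)) => [h|h].
    by apply: srt; rewrite size_map.
  by rewrite [X in X <= _]nth_default ?size_map.
apply/andP; split.
  by apply/(sortedP 0) => k _; rewrite !nth_shape; apply: h1.
apply/(nthP 0) => -[k]; rewrite size_map nth_shape => /h0.
by case: size.
Qed.

Lemma nonempty_rows_ext T T' :
  (forall k, k < size T -> 0 < size (nth [::] T k)) ->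
  (forall k, k < size T' -> 0 < size (nth [::] T' k)) ->
  (forall k, nth [::] T k = nth [::] T' k) -> T = T'.
Proof.
move=> n0 n0' e; apply: (@eq_from_nth _ [::]) => //.
have [h|h|//] := ltngtP (size T) (size T').
  by have := n0' _ h; rewrite -e nth_default.
by have := n0 _ h; rewrite e nth_default.
Qed.

(** The rows are cut at the first empty one; since lengths decrease, all later ones are empty
    too. *)
Lemma rows_exist (f : nat -> seq A) M :
  (forall k, M <= k -> f k = [::]) ->
  (forall k, size (f k.+1) <= size (f k)) ->
  exists2 T, is_part (shape T) & forall k, nth [::] T k = f k.
Proof.
move=> f0 dec.
have ex0 : exists k, nilp (f k) by exists M; rewrite f0.
case: (ex_minnP ex0) => l /nilP fl minl.
have nthE k : nth [::] (mkseq f l) k = f k.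
  case: (ltnP k l) => h; first by rewrite nth_mkseq.
  rewrite nth_default ?size_mkseq //; apply/esym/size0nil/eqP.
  rewrite -leqn0; elim: k h => [|k IH].
    by rewrite leqn0 => /eqP <-; rewrite fl.
  by rewrite leq_eqVlt => /orP[/eqP <-|/IH]; [rewrite fl | apply: leq_trans].
exists (mkseq f l) => //; apply/part_shapeP; split=> k; rewrite !nthE //.
by rewrite size_mkseq lt0n => kl; apply: contraTN kl => /minl; rewrite -leqNgt.
Qed.

End Rows.

Lemma count_flatten_rows (A : Type) (P : pred A) (T : seq (seq A)) M :
  size T <= M -> count P (flatten T) = \sum_(k < M) count P (nth [::] T k).
Proof.
elim: T M => [|r T IH] [|M] //=; first by rewrite big_ord0.
  by move=> _; rewrite big1 // => k _; rewrite nth_nil.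
by move=> h; rewrite count_cat big_ord_recl /= (IH M).
Qed.

(** * Semistandard tableaux as Gelfand-Tsetlin patterns *)

Definition is_bounded_ssyt (m : nat) (T : seq (seq nat)) : Prop :=
  [/\ is_part (shape T), is_ssyt (shape T) T & all (leq^~ m) (flatten T)].

Fixpoint pattern_of (m : nat) (T : seq (seq nat)) : seq (nat -> nat) :=
  if m is m'.+1 then
    (fun k => count (leq^~ m) (nth [::] T k)) :: pattern_of m' T
  else [::].

Lemma size_pattern_of m T : size (pattern_of m T) = m.
Proof. by elim: m => //= m ->. Qed.

Lemma all_flatten_nth (A : Type) (P : pred A) (T : seq (seq A)) k :
  all P (flatten T) -> all P (nth [::] T k).
Proof. by elim: T k => [|r T IH] [|k] //=; rewrite all_cat => /andP[] // _ /IH. Qed.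

Section PatternOf.

Variables (m : nat) (T : seq (seq nat)).
Hypothesis hT : is_bounded_ssyt m T.

Let pos k : all (fun e => 0 < e) (nth [::] T k).
Proof. by case: hT => _ /and3P[/andP[_ h] _ _] _; apply: all_flatten_nth. Qed.

Let bnd k : all (leq^~ m) (nth [::] T k).
Proof. by case: hT => _ _ h; apply: all_flatten_nth. Qed.

Lemma ssyt_rows_sorted k : sorted leq (nth [::] T k).
Proof.
case: hT => _ /and3P[_ h _] _; case: (ltnP k (size T)) => hk.
  exact: (allP h _ (mem_nth _ hk)).
by rewrite nth_default.
Qed.

Lemma top_pattern_of_le n k :
  top (pattern_of n T) k = count (leq^~ n) (nth [::] T k).
Proof.
(* For [n = 0] the pattern is empty and its [top] defaults to zero, which is correct because entries
   are positive. *)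
case: n => //=; apply/esym/eqP; rewrite -leqn0 leqNgt -has_count.
by apply/hasPn => x /(allP (pos k)); rewrite -ltnNge.
Qed.

Lemma top_pattern_of k : top (pattern_of m T) k = size (nth [::] T k).
Proof. by rewrite top_pattern_of_le; apply/eqP; rewrite -all_count. Qed.

(** The lower half of the interlacing is strictness of the columns; the upper half is monotonicity
    of counts. *)
Lemma pattern_ofP n : is_pattern (pattern_of n T).
Proof.
elim: n => //= n IH; split=> // k; rewrite !top_pattern_of_le; apply/andP; split.
  case: hT => /part_shapeP[_ dec] /and3P[_ _ /increasing_columnsP inc] _.
  apply: (@columns_count _ 0 leq ltn _ _ leq_trans _ _ _ n.+1) => //.
  - by move=> a b; apply: ltnNge.
  - exact: ssyt_rows_sorted.
  - exact: ssyt_rows_sorted.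
by apply: sub_count => x /=; lia.
Qed.

Lemma size_bounded_ssyt : size T <= m.
Proof.
case: hT => /part_shapeP[h _] _ _; rewrite leqNgt; apply/negP => /h.
by rewrite -top_pattern_of pattern_top0 ?size_pattern_of //; apply: pattern_ofP.
Qed.

Lemma pattern_of_weight y : pweight m (pattern_of m T) y = weight T y.
Proof.
have weight_mem n : \sum_(k < m) count (leq^~ n) (nth [::] T k)
    = count (leq^~ n) (flatten T).
  by rewrite (count_flatten_rows _ size_bounded_ssyt).
suff gen n : pweight m (pattern_of n T) y =
    if y <= n then weight T y else 0.
  rewrite gen; case: leqP => // my; apply/esym/count_memPn/negP.
  by case: hT => _ _ /allP h /h; lia.
have pm : 0 \notin flatten T.
  by case: hT => _ /and3P[/andP[_ /allP h] _ _] _; apply/negP => /h.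
elim: n => /= [|n IH].
  by rewrite leqn0; case: eqP => // ->; apply/esym/count_memPn.
rewrite size_pattern_of IH; case: eqP => [->|ne]; last by congr (if _ then _ else _); lia.
rewrite leqnn; under [X in _ - X]eq_bigr do rewrite top_pattern_of_le.
rewrite !weight_mem /weight; elim: (flatten T) {pm} => //= x s IHs.
have : count (leq^~ n) s <= count (leq^~ n.+1) s by apply: sub_count => z /=; lia.
by lia.
Qed.

End PatternOf.

Lemma count_mem_leq (s : seq nat) y :
  count_mem y.+1 s = count (leq^~ y.+1) s - count (leq^~ y) s.
Proof.
elim: s => //= x s ->.
have : count (leq^~ y) s <= count (leq^~ y.+1) s by apply: sub_count => z /=; lia.
by lia.
Qed.

(** The pattern gives, in each row, the number of entries at most [n] for every [n], hence all
    multiplicities, and the rows are sorted. *)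
Lemma pattern_of_inj m T T' : is_bounded_ssyt m T -> is_bounded_ssyt m T' ->
  pattern_of m T = pattern_of m T' -> T = T'.
Proof.
move=> hT hT' e.
have eqn n : n <= m -> pattern_of n T = pattern_of n T'.
  elim: m e {hT hT'} => [|m' IH] e; first by case: n.
  rewrite leq_eqVlt => /orP[/eqP -> //|nm]; apply: IH => //.
  by case: e.
have cnt n k : n <= m ->
    count (leq^~ n) (nth [::] T k) = count (leq^~ n) (nth [::] T' k).
  by move=> nm; rewrite -(top_pattern_of_le hT) -(top_pattern_of_le hT') eqn.
case: (hT) (hT') => /part_shapeP[n0 _] /and3P[/andP[_ pos] _ _] bnd
  [/part_shapeP[n0' _] /and3P[/andP[_ pos'] _ _] bnd'].
apply: nonempty_rows_ext => // k.
apply: (sorted_eq leq_trans anti_leq (ssyt_rows_sorted hT k)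
  (ssyt_rows_sorted hT' k)).
rewrite /perm_eq; apply/allP => y; rewrite mem_cat => hy.
have /andP[y0 ym] : 0 < y <= m.
  case/orP: hy => hy.
    by rewrite (allP (all_flatten_nth k pos)) ?(allP (all_flatten_nth k bnd)).
  by rewrite (allP (all_flatten_nth k pos')) ?(allP (all_flatten_nth k bnd')).
by apply/eqP => /=; rewrite -(prednK y0) !count_mem_leq !cnt //; lia.
Qed.

Fixpoint pattern_row (p : seq (nat -> nat)) (k : nat) : seq nat :=
  if p is la :: p' then pattern_row p' k ++ nseq (la k - top p' k) (size p)
  else [::].

Section PatternRow.

Variables (p : seq (nat -> nat)) (k : nat).
Hypothesis pat : is_pattern p.

Lemma pattern_row_bounds : all (fun e => 0 < e <= size p) (pattern_row p k).
Proof.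
clear pat; elim: p => //= la p' IH; rewrite all_cat all_nseq leqnn orbT andbT.
by apply: sub_all IH => e; lia.
Qed.

Lemma size_pattern_row : size (pattern_row p k) = top p k.
Proof.
elim: p pat => //= la p' IH [il pat'].
by rewrite size_cat size_nseq IH // subnKC //; have := il k; lia.
Qed.

Lemma count_pattern_row n : size p <= n ->
  count (leq^~ n) (pattern_row p k) = top p k.
Proof.
move=> pn; rewrite -size_pattern_row; apply/eqP; rewrite -all_count.
by apply: sub_all pattern_row_bounds => e; lia.
Qed.

End PatternRow.

Lemma pattern_row_sorted p k : sorted leq (pattern_row p k).
Proof.
elim: p => //= la p IH; rewrite (sorted_pairwise leq_trans) pairwise_cat.
rewrite -(sorted_pairwise leq_trans) IH /=; apply/andP; split.
  apply/allrelP => x y /(allP (pattern_row_bounds p k)) /= hx.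
  by rewrite mem_nseq => /andP[_ /eqP ->]; lia.
by elim: (_ - _) => //= n ->; rewrite all_nseq leqnn orbT.
Qed.

(** Either the largest letter counts on neither side and induction applies, or all letters below it
    count on the right and the bound is [la k.+1 <= top p k]. *)
Lemma pattern_row_columns p b k : is_pattern p ->
  count (leq^~ b.+1) (pattern_row p k.+1) <= count (leq^~ b) (pattern_row p k).
Proof.
elim: p => //= la p IH [il pat]; rewrite !count_cat !count_nseq.
case: (ltnP b.+1 (size p).+1) => h.
  by have := IH pat; rewrite mul0n; lia.
rewrite !count_pattern_row //; last lia.
by have := il k; have := il k.+1; lia.
Qed.

Lemma pattern_of_surj m p : size p = m -> is_pattern p ->
  exists2 T, is_bounded_ssyt m T & pattern_of m T = p.
Proof.
move=> szp pat.
have [||T prt nthT] := @rows_exist _ (pattern_row p) m.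
- by move=> k hk; apply: size0nil; rewrite size_pattern_row // pattern_top0 ?szp.
- by move=> k; rewrite !size_pattern_row // pattern_decr.
have inT e : e \in flatten T -> 0 < e <= m.
  case/flattenP => r /(nthP [::])[k kT <-]; rewrite nthT => he.
  by rewrite -szp (allP (pattern_row_bounds p k)).
exists T.
  split=> //; last by apply/allP => e /inT /andP[].
  apply/and3P; split.
  - by rewrite /is_filling eqxx; apply/allP => e /inT /andP[].
  - by apply/allP => r /(nthP [::])[k kT <-]; rewrite nthT pattern_row_sorted.
  apply/increasing_columnsP => k; rewrite !nthT.
  apply: (@count_columns _ 0 leq ltn _ _ leqnn leq_trans).
  - by move=> a b; apply: ltnNge.
  - exact: pattern_row_sorted.
  - exact: pattern_row_sorted.
  case=> [|b] /(allP (pattern_row_bounds p _)) //= _.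
  exact: pattern_row_columns.
(* Generalized for the induction on [p]: removing the top level moves its letter into the suffix
   [s], whose entries exceed the remaining alphabet. *)
have {nthT} : forall k, exists2 s, nth [::] T k = pattern_row p k ++ s
    & all (ltn m) s by move=> k; exists [::]; rewrite ?nthT ?cats0.
elim: p m szp pat {prt inT} => [|la p IH] [|m] //= [szp] [il pat] rowE.
congr (_ :: _).
  apply/funext => k; have [s -> sm] := rowE k; rewrite !count_cat.
  rewrite (@eq_in_count _ _ pred0 s); last by move=> x /(allP sm) /=; lia.
  rewrite count_pred0 count_pattern_row; [|done|lia].
  by rewrite count_nseq; have := il k; lia.
apply: IH => // k; have [s -> sm] := rowE k.
exists (nseq (la k - top p k) (size p).+1 ++ s); rewrite ?catA //.
rewrite all_cat all_nseq /= szp ltnSn orbT /=.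
by apply: sub_all sm => x /=; lia.
Qed.

Lemma part_ext la la' : is_part la -> is_part la' ->
  (forall k, nth 0 la k = nth 0 la' k) -> la = la'.
Proof.
move=> /andP[_ n0] /andP[_ n0'] e; apply: (@eq_from_nth _ 0) => //.
have [h|h|//] := ltngtP (size la) (size la').
  by have := mem_nth 0 h; rewrite -e nth_default // (negPf n0').
by have := mem_nth 0 h; rewrite e nth_default // (negPf n0).
Qed.

(** * The prismatic and co-prismatic orders *)

Lemma prism_trans : transitive prism_lt.
Proof. by move=> [a b] [c d] [e f]; rewrite /prism_lt /=; lia. Qed.

Lemma prism_irr : irreflexive prism_lt.
Proof. by move=> [a b]; rewrite /prism_lt /=; lia. Qed.

Lemma coprism_irr : irreflexive coprism_lt.
Proof. by move=> [a b]; rewrite /coprism_lt /=; lia. Qed.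

Lemma coprism_trans : transitive coprism_lt.
Proof. by move=> [a b] [c d] [e f]; rewrite /coprism_lt /=; lia. Qed.

Lemma coprism_le_refl : reflexive coprism_le.
Proof. by move=> a; rewrite /coprism_le eqxx. Qed.

Lemma coprism_le_trans : transitive coprism_le.
Proof.
move=> [a b] [c d] [e f]; rewrite /coprism_le /coprism_lt /= -!pair_eqE /=; lia.
Qed.

Lemma coprism_le_total : total coprism_le.
Proof.
by move=> [a b] [c d]; rewrite /coprism_le /coprism_lt /= -!pair_eqE /=; lia.
Qed.

Lemma coprism_ltNge a b : coprism_lt a b = ~~ coprism_le b a.
Proof.
by case: a b => [a b] [c d]; rewrite /coprism_le /coprism_lt /= -!pair_eqE /=; lia.
Qed.

Definition prism_le (a b : nat * nat) : bool := (a == b) || prism_lt a b.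

Lemma prism_le_total : total prism_le.
Proof.
by move=> [a b] [c d]; rewrite /prism_le /prism_lt /= -!pair_eqE /=; lia.
Qed.

Lemma prism_le_trans : transitive prism_le.
Proof.
by move=> [a b] [c d] [e f]; rewrite /prism_le /prism_lt /= -!pair_eqE /=; lia.
Qed.

Lemma sorted_prism_lt s : uniq s -> sorted prism_le s -> sorted prism_lt s.
Proof.
rewrite uniq_pairwise (sorted_pairwise prism_le_trans)
  (sorted_pairwise prism_trans) => ne le.
have : pairwise [rel x y | [rel a b | a != b] x y && prism_le x y] s.
  by rewrite pairwise_relI ne.
by apply: sub_pairwise => a b /=; rewrite /prism_le; case: eqP.
Qed.

Lemma map_nth_index (A : eqType) (r : seq A) (s : seq nat) :
  uniq r -> size s = size r -> [seq nth 0 s (index a r) | a <- r] = s.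
Proof.
move=> ur sz; apply: (@eq_from_nth _ 0) => [|i]; rewrite size_map // => ir.
by case: r ur sz ir => // a r ur sz ir; rewrite (nth_map a) // index_uniq.
Qed.

(** * The reading order and the rows of a tabloid *)

Section Reading.

Variable mu : seq nat.
Hypothesis hmu : is_part mu.

(* The colored letters in decreasing co-prismatic order. *)
Definition reading : seq (nat * nat) :=
  rev [seq (x, y) | y <- iota 1 (part mu 1), x <- iota 1 (conj_part mu y)].

Lemma reading_pairwise : pairwise (fun a b => coprism_lt b a) reading.
Proof.
rewrite -sorted_pairwise; last by apply: rev_trans; apply: coprism_trans.
rewrite rev_sorted (sorted_pairwise coprism_trans).
have := iota_ltn_sorted 1 (part mu 1); rewrite (sorted_pairwise ltn_trans).
elim: (iota 1 (part mu 1)) => // y s IH; rewrite pairwise_cons => /andP[ys /IH].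
rewrite allpairs_cons pairwise_cat => ->; rewrite andbT; apply/andP; split.
  apply/allrelP => _ q /mapP[x _ ->] /allpairsPdep[y' [x' [y's _ ->]]].
  by rewrite /coprism_lt /= (allP ys).
rewrite pairwise_map; have := iota_ltn_sorted 1 (conj_part mu y).
rewrite (sorted_pairwise ltn_trans); apply: sub_pairwise => a b /=.
by rewrite /coprism_lt /= eqxx => ->; rewrite orbT.
Qed.

Lemma reading_uniq : uniq reading.
Proof. by apply: (pairwise_uniq _ reading_pairwise) => a; apply: coprism_irr. Qed.

Lemma part_geq x y : 0 < x -> 0 < y ->
  (x <= conj_part mu y) = (y <= part mu x).
Proof.
case: x => // x _ y0; have /andP[srt _] := hmu.
rewrite /conj_part (sorted_count 0 _ _ _ srt).
- by case: ltnP => //= h; rewrite nth_default //; lia.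
- by move=> a b c /= ab bc; apply: leq_trans ab.
- by move=> a b /= ba yb; apply: leq_trans ba.
Qed.

Lemma mem_reading x y :
  ((x, y) \in reading) = [&& 0 < x, 0 < y & y <= part mu x].
Proof.
rewrite mem_rev; apply/allpairsPdep/idP => [[y' [x' [+ + [-> ->]]]]|].
  by rewrite !mem_iota => ? ?; rewrite -part_geq; lia.
move=> /and3P[x0 y0 yx]; exists y, x; rewrite !mem_iota.
split=> //; last by have := part_geq x0 y0; lia.
have := part_geq (ltn0Sn 0) y0; have := part_geq x0 y0; lia.
Qed.

Lemma mem_colored_letters x y :
  ((x, y) \in colored_letters mu) = [&& 0 < x, 0 < y & y <= part mu x].
Proof.
apply/allpairsPdep/idP => [[x' [y' [+ + [-> ->]]]]|/and3P[x0 y0 yx]].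
  by rewrite !mem_iota => ? ?; lia.
exists x, y; rewrite !mem_iota; split=> //; last lia.
case: x x0 yx => //= x _ yx; case: (ltnP x (size mu)) => // h.
by move: yx; rewrite nth_default //; lia.
Qed.

Lemma perm_reading : perm_eq reading (colored_letters mu).
Proof.
apply: uniq_perm; first exact: reading_uniq.
  apply: allpairs_uniq_dep => [|x _|]; [exact: iota_uniq | exact: iota_uniq |].
  by move=> [a b] [c d] _ _ /= [-> ->].
by move=> [x y]; rewrite mem_reading mem_colored_letters.
Qed.

(** The reading runs through each column of [mu] from top to bottom, so vertical neighbours are
    adjacent. Comparisons inside columns thus become comparisons of adjacent positions of a word. *)
Lemma reading_consecutive x y : 1 < x -> (x, y) \in reading ->
  exists A B, reading = A ++ (x, y) :: (x.-1, y) :: B.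
Proof.
move=> x1 hxy; have x0 : 0 < x by lia.
move: hxy; rewrite mem_reading => /and3P[_ y0 yx].
have iotaE n : x <= n ->
    iota 1 n = iota 1 x.-2 ++ x.-1 :: x :: iota x.+1 (n - x).
  move=> xn; have -> : n = x.-2 + (2 + (n - x)) by lia.
  rewrite iotaD /=; congr (_ ++ [:: _, _ & iota _ _]); lia.
have : y \in iota 1 (part mu 1).
  rewrite mem_iota; have := part_geq (ltn0Sn 0) y0; have := part_geq x0 y0; lia.
rewrite /reading; move: (iota 1 _) => s /path.splitPr[s1 s2].
rewrite map_cat flatten_cat /= (iotaE (conj_part mu y)) ?part_geq //.
rewrite map_cat /= rev_cat rev_cat rev_cat !rev_cons -!cats1 -!catA /=.
by rewrite catA; do 2 eexists.
Qed.

(** In a co-prismatically decreasing list, what follows [p] is exactly the set of letters smaller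
    than [p], so the condition of [is_yam] on tails can be stated letter by letter. *)
Lemma is_yam_map (f : nat * nat -> nat) (L : seq (nat * nat)) :
  pairwise (fun a b => coprism_lt b a) L ->
  is_yam (map f L) <->
  forall p, p \in L -> f p = 0 \/
    count (fun q => coprism_lt q p && (f q == f p)) L
      < count (fun q => coprism_lt q p && (f q == (f p).-1)) L.
Proof.
elim: L => //= p L IH /andP[/allP pL /IH {}IH].
have cnt k : count (fun q => coprism_lt q p && (f q == k)) L
    = count_mem k (map f L).
  by rewrite count_map; apply: eq_in_count => q /pL /= ->.
have ncop q : q \in L -> coprism_lt p q = false.
  move=> /pL qp; apply/negP => /coprism_trans /(_ qp).
  by rewrite coprism_irr.
rewrite -!cnt; split.
  move=> /andP[hp /IH h] q; rewrite inE => /predU1P[->|qL].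
    by rewrite coprism_irr /=; case/orP: hp => [/eqP|]; [left | right].
  by rewrite ncop //=; apply: h.
move=> h; apply/andP; split.
  have [|->|] := h p; rewrite ?inE ?eqxx //.
  by rewrite coprism_irr !add0n => ->; rewrite orbT.
by apply/IH => q qL; have := h q; rewrite inE qL orbT ncop //= => /(_ isT).
Qed.

Definition row_of (T : seq (seq (nat * nat))) (p : nat * nat) : nat :=
  find (fun r => p \in r) T.

Lemma uniq_row (T : seq (seq (nat * nat))) k : uniq (flatten T) -> uniq (nth [::] T k).
Proof.
elim: T k => [|r T IH] [|k] //= ; rewrite cat_uniq => /and3P[] // _ _.
exact: IH.
Qed.

Lemma mem_row (T : seq (seq (nat * nat))) k p : p \in nth [::] T k -> p \in flatten T.
Proof.
move=> pk; apply/flattenP; exists (nth [::] T k) => //.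
by case: (ltnP k (size T)) pk => h; [rewrite mem_nth | rewrite nth_default].
Qed.

Lemma row_ofP T p k : uniq (flatten T) -> p \in flatten T ->
  (row_of T p == k) = (p \in nth [::] T k).
Proof.
elim: T k => //= r T IH k; rewrite cat_uniq mem_cat => /and3P[_ /hasPn d u].
rewrite /row_of /=; case: ifP => /= [pr _|pr pT].
  case: k => [|k] /=; first by rewrite pr.
  by apply/esym/negP => /mem_row/d; rewrite /= pr.
by case: k => [|k] /=; rewrite ?pr // eqSS IH.
Qed.

Lemma count_row T k (P : pred (nat * nat)) : perm_eq (flatten T) reading ->
  count P (nth [::] T k) = count (fun q => P q && (row_of T q == k)) reading.
Proof.
move=> pT; have uT : uniq (flatten T) by rewrite (perm_uniq pT) reading_uniq.
have mT := perm_mem pT.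
rewrite -count_filter; apply/permP: P; apply: uniq_perm.
- exact: uniq_row.
- exact: filter_uniq reading_uniq.
move=> q; rewrite mem_filter -mT; case: (boolP (q \in flatten T)) => qT.
  by rewrite andbT row_ofP.
by rewrite andbF; apply: contraNF qT; apply: mem_row.
Qed.

End Reading.

(** On the circle lower rows come first, and within one row the larger letter [b] precedes [a]. *)
Lemma passes_starE T a b : all (sorted prism_lt) T ->
  a \in flatten T -> b \in flatten T -> prism_lt a b ->
  passes_star T a b = (row_of T b <= row_of T a).
Proof.
rewrite /passes_star /row_of /circle => + + + ab.
elim: T => //= r T IH /andP[sr sT]; rewrite !mem_cat !index_cat !mem_rev size_rev.
case ar: (a \in r); case br: (b \in r) => /=.
- move=> _ _; rewrite leqnn.
  case: ltngtP => // h.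
    have srr : sorted (fun x y => prism_lt y x) (rev r) by rewrite rev_sorted.
    have := sorted_ltn_index (rev_trans prism_trans) srr.
    move=> /(_ a b); rewrite !mem_rev ar br => /(_ isT isT h) ba.
    by have := prism_trans ab ba; rewrite prism_irr.
  have e : a = b by apply: (@index_inj _ a (rev r)); rewrite ?mem_rev ?ar ?br ?h.
  by rewrite e prism_irr in ab.
- move=> _ _; have : index a (rev r) < size r by rewrite -size_rev index_mem mem_rev.
  by lia.
- move=> _ _; have : index b (rev r) < size r by rewrite -size_rev index_mem mem_rev.
  by lia.
by move=> aT bT; rewrite ltn_add2l IH.
Qed.

(** * Semistandard colored tabloids as Yamanouchi words *)

Section Tabloids.

Variable mu : seq nat.
Hypothesis hmu : is_part mu.

Definition row_word (T : seq (seq (nat * nat))) : seq nat :=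
  map (row_of T) (reading mu).

Lemma count_row_word T k : perm_eq (flatten T) (reading mu) ->
  count_mem k (row_word T) = size (nth [::] T k).
Proof. by move=> pT; rewrite count_map -[RHS]count_predT (count_row k _ pT). Qed.

(** For a letter [p] of row [k.+1], both conditions bound the number of letters up to [p] in row
    [k.+1] by the number of letters before [p] in row [k]; counting [p] itself turns [<=] into
    [<]. *)
Lemma coprism_columns_yam T :
  perm_eq (flatten T) (reading mu) ->
  (forall k, size (nth [::] T k.+1) <= size (nth [::] T k)) ->
  increasing_columns coprism_lt (map (sort coprism_le) T) <->
  is_yam (row_word T).
Proof.
move=> pT dec.
have nth_sort k : nth [::] (map (sort coprism_le) T) k
    = sort coprism_le (nth [::] T k).
  case: (ltnP k (size T)) => h; first by rewrite (nth_map [::]).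
  by rewrite !nth_default ?size_map.
have srt k := sort_sorted coprism_le_total (nth [::] T k).
have uT : uniq (flatten T) by rewrite (perm_uniq pT) reading_uniq.
have cnt_lt b k : count (coprism_lt^~ b) (nth [::] T k)
    = count (fun q => coprism_lt q b && (row_of T q == k)) (reading mu).
  exact: count_row.
have cnt_le b r : b \in r -> uniq r ->
    count (coprism_le^~ b) r = (count (coprism_lt^~ b) r).+1.
  move=> br ur; rewrite -addn1 -[1]/(nat_of_bool true) -br -count_uniq_mem //.
  elim: r {br ur} => //= q r ->; rewrite /coprism_le.
  by case: eqP => [->|_]; rewrite ?coprism_irr /=; lia.
rewrite increasing_columnsP (is_yam_map (row_of T) (reading_pairwise mu)); split.
  move=> inc p pL; case e: (row_of T p) => [|k]; [by left | right].
  have pk : p \in nth [::] T k.+1.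
    by rewrite -(row_ofP _ uT) ?e // (perm_mem pT).
  have := inc k; rewrite !nth_sort => inck.
  have := @columns_count _ (0, 0) _ _ _ _ coprism_le_trans coprism_ltNge
    (srt k) (srt k.+1) p _ inck.
  rewrite !size_sort => /(_ (dec k)).
  by rewrite !(permP (permEl (perm_sort _ _))) cnt_le ?uniq_row // !cnt_lt.
move=> yam k; rewrite !nth_sort.
apply: (@count_columns _ (0, 0) _ _ _ _ coprism_le_refl coprism_le_trans
  coprism_ltNge (srt k) (srt k.+1)) => p.
rewrite mem_sort => pk.
rewrite !(permP (permEl (perm_sort _ _))) cnt_le ?uniq_row // !cnt_lt.
have := yam p; rewrite -(perm_mem pT) => /(_ (mem_row pk)).
have -> : row_of T p = k.+1.
  by apply/eqP; rewrite row_ofP // (mem_row pk).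
by case.
Qed.

Lemma row_word_inj T T' : is_ssct mu T -> is_ssct mu T' ->
  row_word T = row_word T' -> T = T'.
Proof.
move=> /and3P[/andP[pT sT] /part_shapeP[n0 _] _].
move=> /and3P[/andP[pT' sT'] /part_shapeP[n0' _] _] /eq_in_map e.
have pmu := perm_reading hmu.
have {}pT : perm_eq (flatten T) (reading mu).
  by rewrite (perm_trans pT) // perm_sym.
have {}pT' : perm_eq (flatten T') (reading mu).
  by rewrite (perm_trans pT') // perm_sym.
have srt (S : seq (seq (nat * nat))) k : all (sorted prism_lt) S ->
    sorted prism_lt (nth [::] S k).
  move=> /allP h; case: (ltnP k (size S)) => hk; last by rewrite nth_default.
  by apply: h; rewrite mem_nth.
apply: nonempty_rows_ext => // k.
apply: (irr_sorted_eq prism_trans prism_irr (srt T k sT) (srt T' k sT')) => q.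
have uT : uniq (flatten T) by rewrite (perm_uniq pT) reading_uniq.
have uT' : uniq (flatten T') by rewrite (perm_uniq pT') reading_uniq.
apply/idP/idP => qk; have := mem_row qk; rewrite ?(perm_mem pT) ?(perm_mem pT') => qL.
  by rewrite -row_ofP ?(perm_mem pT') // -e // row_ofP ?(perm_mem pT).
by rewrite -row_ofP ?(perm_mem pT) // e // row_ofP ?(perm_mem pT').
Qed.

(** Row [k] collects the letters at whose reading positions [j] has the value [k]; the Yamanouchi
    condition gives both a partition shape and increasing columns. *)
Lemma row_word_surj j : is_yam j -> size j = size (reading mu) ->
  exists2 T, is_ssct mu T & row_word T = j.
Proof.
move=> yam szj; pose L := reading mu; pose f q := nth 0 j (index q L).
have uL : uniq L by apply: reading_uniq.
have mapf : map f L = j by apply: map_nth_index.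
have cntf k : size (sort prism_le [seq q <- L | f q == k]) = count_mem k j.
  by rewrite size_sort size_filter -mapf count_map.
have [||T prt nthT] := @rows_exist _ (fun k => sort prism_le [seq q <- L | f q == k])
    (\max_(q <- L) f q).+1.
- move=> k hk; apply: size0nil; rewrite size_sort size_filter; apply/eqP.
  rewrite -leqn0 leqNgt -has_count; apply/hasPn => q qL.
  have := @leq_bigmax_seq _ L xpredT f q qL isT.
  by move=> le; apply/negP => /= /eqP e; move: hk; rewrite -e ltnNge le.
- by move=> k; rewrite !cntf yam_decr.
have mem_nthT q k : (q \in nth [::] T k) = (f q == k) && (q \in L).
  by rewrite nthT mem_sort mem_filter.
have pT : perm_eq (flatten T) L.
  apply/allP => q; rewrite mem_cat => hq.
  have qL : q \in L.
    case/orP: hq => // /flattenP[r /(nthP [::])[k _ <-]].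
    by rewrite mem_nthT => /andP[].
  apply/eqP => /=.
  rewrite (count_uniq_mem _ uL) qL.
  pose M := maxn (size T) (f q).+1.
  rewrite (@count_flatten_rows _ _ _ M) ?leq_maxl //.
  have fM : f q < M by rewrite leq_maxr.
  rewrite (bigD1 (Ordinal fM)) //= big1 => [|k nk]; rewrite count_uniq_mem.
  - by rewrite mem_nthT eqxx qL.
  - by rewrite nthT sort_uniq filter_uniq.
  - by rewrite mem_nthT (eq_sym (f q)); move: nk; rewrite -val_eqE /= => /negPf ->.
  - by rewrite nthT sort_uniq filter_uniq.
have uT : uniq (flatten T) by rewrite (perm_uniq pT).
have jT : row_word T = j.
  rewrite -mapf; apply/eq_in_map => q qL; apply/eqP.
  by rewrite row_ofP ?(perm_mem pT) // mem_nthT eqxx.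
exists T => //; apply/and3P; split=> //; last first.
  by apply/coprism_columns_yam; rewrite ?jT //; case/part_shapeP: prt.
rewrite /is_colored_tabloid (perm_trans pT (perm_reading hmu)) /=.
apply/allP => r /(nthP [::])[k _ <-]; apply: sorted_prism_lt.
  exact: uniq_row.
by rewrite nthT sort_sorted //; apply: prism_le_total.
Qed.

Lemma ssct_yam T : is_ssct mu T ->
  perm_eq (flatten T) (reading mu) /\ is_yam (row_word T).
Proof.
move=> /and3P[/andP[pT _] /part_shapeP[_ dec] inc].
have {}pT : perm_eq (flatten T) (reading mu).
  by rewrite (perm_trans pT) // perm_sym perm_reading.
by split=> //; apply/coprism_columns_yam.
Qed.

End Tabloids.

(** * Major index and cocharge *)

(** The increment [d x] contributes to every partial sum from [x] to [n], hence [n - x + 1]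
    times. *)
Lemma sum_partial_sums (d g : nat -> nat) n :
  g 1 = 0 -> (forall a, g a.+2 = g a.+1 + d a.+2) ->
  \sum_(1 <= a < n.+1) g a
    = \sum_(1 <= x < n.+1) (1 < x) * d x * (n - x + 1).
Proof.
move=> g1 gS.
have gE k : g k.+1 = \sum_(1 <= x < k.+2) (1 < x) * d x.
  elim: k => [|k IH]; first by rewrite big_nat1.
  by rewrite gS IH [in RHS]big_nat_recr //= mul1n.
elim: n => [|n IH]; first by rewrite !big_geq.
rewrite big_nat_recr //= IH gE !(big_nat_recr n.+1) //=.
rewrite subnn add0n muln1 addnA; congr (_ + _).
rewrite -big_split /=; apply: eq_big_nat => x hx.
by rewrite -mulnSr addn1 subSn ?addn1 //; lia.
Qed.

Section Statistics.

Variable mu : seq nat.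
Hypothesis hmu : is_part mu.

(** The common form of both statistics, identifying the cell in row [x] and column [y] of [mu] with
    the colored letter [x_y]: for [maj], [u] is the entry of the cell; for [cocharge], the row of
    the letter. *)
Definition ascent_sum (u : nat * nat -> nat) : nat :=
  \sum_(p <- reading mu) ((1 < p.1) && (u (p.1.-1, p.2) < u p))
    * (conj_part mu p.2 - p.1 + 1).

Lemma maj_ascent_sum F : maj mu F = ascent_sum (fun p => entry F p.1 p.2).
Proof.
rewrite /ascent_sum (perm_big _ (perm_reading hmu)) big_allpairs_dep /=.
rewrite /maj; transitivity (\sum_(1 <= r < (size mu).+1)
   \sum_(1 <= c < (part mu r).+1)
      ((1 < r) && (entry F r.-1 c < entry F r c)) * (conj_part mu c - r + 1)).
  case: (size mu) => [|n]; first by rewrite !big_geq.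
  rewrite [in RHS]big_ltn // [X in _ = X + _]big1 // add0n.
  apply: eq_big_nat => r /andP[r1 _]; rewrite big_mkcond /= r1.
  by apply: eq_bigr => c _ /=; case: ifP => _; rewrite ?mul1n ?mul0n.
rewrite /index_iota subn1 /=; apply: eq_bigr => r _.
by rewrite subn1 /=.
Qed.

(** A label grows exactly when the star is not passed, that is, when the letter lies in a strictly
    higher row than its predecessor of the same color. Labels are partial sums of these
    increments. *)
Lemma cocharge_ascent_sum T : is_ssct mu T ->
  cocharge mu T = ascent_sum (row_of T).
Proof.
move=> sT; have [pT _] := ssct_yam hmu sT.
have /and3P[/andP[_ srt] _ _] := sT.
rewrite /ascent_sum /reading (perm_big _ (permEl (perm_rev _))) /=.
rewrite big_allpairs_dep /cocharge {1}/index_iota subn1.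
apply: eq_big_seq => i; rewrite mem_iota => hi.
have -> : iota 1 (conj_part mu i) = index_iota 1 (conj_part mu i).+1.
  by rewrite /index_iota subn1.
pose d x := nat_of_bool (~~ passes_star T (x.-1, i) (x, i)).
rewrite (@sum_partial_sums d) //; last first.
  by move=> a; rewrite /d /=; case: ifP; rewrite ?addn0 ?addn1.
apply: eq_big_nat => x hx; congr (_ * _).
case: ltnP => x1; rewrite ?mul1n ?mul0n //= /d.
have xT y : 0 < y <= x -> (y, i) \in flatten T.
  move=> hy; rewrite (perm_mem pT) mem_reading // -part_geq //; lia.
rewrite (passes_starE srt) -?ltnNge ?xT //; try lia.
by rewrite /prism_lt /=; lia.
Qed.

(** By [reading_consecutive], the sum only sees the descents of the word of values at adjacent
    positions. *)
Lemma ascent_sum_words (u v : nat * nat -> nat) :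
  (forall i, i.+1 < size (reading mu) ->
    (nth 0 (map u (reading mu)) i.+1 < nth 0 (map u (reading mu)) i)
    = (nth 0 (map v (reading mu)) i.+1 < nth 0 (map v (reading mu)) i)) ->
  ascent_sum u = ascent_sum v.
Proof.
move=> h; apply: eq_big_seq => -[x y] pL; congr (nat_of_bool _ * _) => /=.
case: ltnP => //= x1.
have [A [B e]] := reading_consecutive hmu x1 pL.
move: h; rewrite e => /(_ (size A)); rewrite size_cat /= -addn2 leq_add2l.
move=> /(_ isT); rewrite !map_cat !nth_cat !size_map ltnn.
have -> : ((size A).+1 < size A) = false by lia.
by rewrite /= subnn subSnn.
Qed.

(** * Fillings as words *)

Definition word (F : seq (seq nat)) : seq nat :=
  map (fun p => entry F p.1 p.2) (reading mu).

Lemma filling_entries F : shape F = mu ->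
  F = [seq [seq entry F x y | y <- iota 1 (part mu x)] | x <- iota 1 (size mu)].
Proof.
move=> e; have sz : size F = size mu by rewrite -e size_map.
apply: (@eq_from_nth _ [::]); first by rewrite size_map size_iota.
move=> k kF; rewrite (nth_map 0) ?size_iota -?sz // nth_iota -?sz //=.
apply: (@eq_from_nth _ 0); first by rewrite size_map size_iota -e nth_shape.
move=> i hi; rewrite (nth_map 0) ?size_iota -?e ?nth_shape // nth_iota //.
Qed.

Lemma perm_word F : shape F = mu -> perm_eq (flatten F) (word F).
Proof.
move=> e; rewrite perm_sym (perm_trans (perm_map _ (perm_reading hmu))) //.
by rewrite map_allpairs [in X in perm_eq _ X](filling_entries e).
Qed.

Lemma word_inj F F' : shape F = mu -> shape F' = mu -> word F = word F' -> F = F'.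
Proof.
move=> e e' /eq_in_map h; rewrite (filling_entries e) (filling_entries e').
apply/eq_in_map => x; rewrite mem_iota => hx.
apply/eq_in_map => y; rewrite mem_iota => hy.
by apply: (h (x, y)); rewrite mem_reading //; lia.
Qed.

Lemma word_surj w : size w = size (reading mu) ->
  exists2 F, shape F = mu & word F = w.
Proof.
move=> sz; exists [seq [seq nth 0 w (index (x, y) (reading mu))
    | y <- iota 1 (part mu x)] | x <- iota 1 (size mu)].
  rewrite /shape -map_comp; apply: (@eq_from_nth _ 0); rewrite size_map size_iota //.
  move=> k hk; rewrite (nth_map 0) ?size_iota // nth_iota //=.
  by rewrite size_map size_iota.
apply: (@eq_from_nth _ 0); rewrite size_map ?sz // => k hk.
rewrite (nth_map (0, 0)) //; set p := nth _ _ k.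
have : p \in reading mu by rewrite mem_nth.
have -> : k = index p (reading mu) by rewrite index_uniq // reading_uniq.
case: p => x y; rewrite mem_reading // => /and3P[x0 y0 yx].
case: x x0 yx => // x _ /= yx; case: y y0 yx => // y _ yx /=.
have xmu : x < size mu.
  by case: (ltnP x (size mu)) yx => // h; rewrite nth_default.
rewrite /entry (nth_map 0) ?size_iota // nth_iota //=.
by rewrite (nth_map 0) ?size_iota // nth_iota.
Qed.

End Statistics.

(** * The correspondence *)

(** The inner index sets are enlarged to their finite union, padding with the neutral element, to
    reduce to a product of index sets. *)
Lemma fsbig_dep_pair (R : Type) (idx : R) (op : Monoid.com_law idx)
    (I J : choiceType) (S : set I) (B : I -> set J) (F : I -> J -> R) :
  finite_set S -> (forall i, S i -> finite_set (B i)) ->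
  \big[op/idx]_(i \in S) \big[op/idx]_(j \in B i) F i j
  = \big[op/idx]_(p \in [set p | S p.1 /\ B p.1 p.2]%classic) F p.1 p.2.
Proof.
move=> finS finB; pose Q := (\bigcup_(i in S) B i)%classic.
have finQ : finite_set Q by apply: bigcup_finite.
transitivity (\big[op/idx]_(i \in S) \big[op/idx]_(j \in Q)
    if j \in B i then F i j else idx).
  apply: eq_fsbigr => i /set_mem Si; rewrite -fsbig_mkcondr.
  apply: eq_fsbigl; apply/seteqP; split=> j; last by case.
  by move=> Bj; split=> //; exists i.
rewrite pair_fsbig //.
transitivity (\big[op/idx]_(p \in (S `*` Q)%classic)
    if p \in [set p | B p.1 p.2]%classic then F p.1 p.2 else idx).
  apply: eq_fsbigr => -[i j] _ /=; congr (if _ then _ else _).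
rewrite -fsbig_mkcondr; apply: eq_fsbigl; apply/seteqP; split=> -[i j] /=.
  by case=> -[].
by case=> Si Bij; split=> //; split=> //; exists i.
Qed.

(** Fillings of equal weight are permutations of one another once flattened, so each is a reshaped
    permutation of a single [F0]. *)
Lemma finite_fixed_weight (sh : seq nat) (alpha : nat -> nat) :
  finite_set [set F | shape F = sh /\ weight F = alpha]%classic.
Proof.
have [[F0 [_ wF0]]|no] := pselect (exists F, shape F = sh /\ weight F = alpha);
  last first.
  by rewrite (_ : mkset _ = set0) //; apply/seteqP; split=> // F h; apply: no; exists F.
apply: (@sub_finite_set _ _ [set` map (reshape sh) (permutations (flatten F0))]%classic);
  last exact: finite_seq.
move=> F [shF wF] /=; apply/mapP; exists (flatten F); last by rewrite -shF flattenK.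
rewrite mem_permutations; apply/allP => y _; apply/eqP => /=.
by rewrite -/(weight F y) wF -wF0.
Qed.

Lemma weight_bounded (F : seq (seq nat)) :
  exists m, forall i, m < i -> weight F i = 0.
Proof.
exists (\max_(i <- flatten F) i) => i hi; apply/count_memPn/negP => iF.
by have := @leq_bigmax_seq _ _ xpredT id i iF isT; rewrite leqNgt hi.
Qed.

Section Correspondence.

Variable mu : seq nat.
Hypothesis hmu : is_part mu.

(** The shape varies, so finiteness comes from the injective [row_word], whose values are words of
    length [N] with letters below [N]. *)
Lemma finite_ssct : finite_set [set T | is_ssct mu T]%classic.
Proof.
set S := mkset _; pose N := size (reading mu).
have injS : {in S &, injective (row_word mu)}.
  by move=> T T' /set_mem sT /set_mem sT'; apply: row_word_inj.
rewrite -(eq_finite_set (inj_card_eq injS)).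
pose words := [seq map val (val t) | t <- enum {: N.-tuple 'I_N}].
apply: (@sub_finite_set _ _ [set` words]%classic); last exact: finite_seq.
move=> _ [T sT <-] /=; have [_ yam] := ssct_yam hmu sT.
have szj : size (row_word mu T) = N by rewrite size_map.
have ltj k : k \in row_word mu T -> k < N by rewrite -szj; apply: yam_lt.
apply/mapP; have sz' : size (pmap insub (row_word mu T) : seq 'I_N) == N.
  rewrite size_pmap_sub -[X in _ == X]szj -all_count; apply/allP.
  exact: ltj.
exists (Tuple sz'); rewrite ?mem_enum //=.
rewrite (pmap_filter (insubK _)); apply/esym/all_filterP/allP => k /ltj kN.
by rewrite /= insubT.
Qed.

Variables (alpha : nat -> nat) (m : nat).
Hypothesis alpha0 : forall i, m < i -> alpha i = 0.

Definition rsk_pairs : set (seq (nat -> nat) * seq nat) :=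
  [set pj | [/\ rsk_pair m pj.1 pj.2, size pj.2 = size (reading mu)
    & pweight m pj.1 = alpha]]%classic.

Lemma weight_le (F : seq (seq nat)) k : weight F = alpha -> k \in flatten F -> k <= m.
Proof.
move=> wF kF; rewrite leqNgt; apply/negP => /alpha0; rewrite -wF => /count_memPn.
by rewrite kF.
Qed.

Lemma word_bounds F : is_filling mu F -> weight F = alpha ->
  all (fun x => 0 < x <= m) (word mu F).
Proof.
move=> /andP[/eqP shF pos] wF; apply/allP => x.
rewrite -(perm_mem (perm_word hmu shF)) => xF.
by rewrite (allP pos) // (weight_le wF).
Qed.

Lemma filling_rsk_bij :
  set_bij [set F | is_filling mu F /\ weight F = alpha]%classic rsk_pairs
    (fun F => rsk m (word mu F)).
Proof.
split.
- move=> F [fF wF] /=; have [pr [_ sz wt]] := rskP (word_bounds fF wF).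
  split=> //; first by rewrite sz size_map.
  apply/funext => y; rewrite wt -wF; case/andP: fF => /eqP shF _.
  exact/esym/(permP (perm_word hmu shF)).
- move=> F F' /set_mem[fF wF] /set_mem[fF' wF'] e.
  have [_ [unr _ _]] := rskP (word_bounds fF wF).
  have [_ [unr' _ _]] := rskP (word_bounds fF' wF').
  case/andP: fF fF' => /eqP shF _ /andP[/eqP shF' _].
  by apply: (word_inj hmu) => //; rewrite -unr -unr' e.
move=> [p j] [/= pr sz wt]; have [szu bnd rs] := unrskP pr.
have [F shF wF] := word_surj hmu (etrans szu sz).
exists F; last by rewrite wF rs.
have pF := perm_word hmu shF; rewrite wF in pF.
split; first (rewrite /is_filling shF eqxx; apply/allP => x).
  by rewrite (perm_mem pF) => /(allP bnd) /andP[].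
have [_ [_ _ wt']] := rskP bnd.
by apply/funext => y; rewrite /weight (permP pF) -wt' rs /= wt.
Qed.

Lemma bounded_ssytP T P : is_part (shape T : seq nat) ->
  is_ssyt (shape (T : seq (seq (nat * nat)))) P -> weight P = alpha ->
  shape P = shape T /\ is_bounded_ssyt m P.
Proof.
move=> prt sP wP; have /and3P[/andP[/eqP shP pos] _ _] := sP.
split=> //; split; rewrite ?shP //; apply/allP => k; exact: weight_le.
Qed.

(** The semistandard tableau plays the insertion tableau and the colored tabloid the recording
    tableau; equality of their shapes is the last clause of [rsk_pair]. *)
Lemma ssct_ssyt_bij :
  set_bij [set TP | is_ssct mu TP.1 /\
      (is_ssyt (shape TP.1) TP.2 /\ weight TP.2 = alpha)]%classic rsk_pairs
    (fun TP => (pattern_of m TP.2, row_word mu TP.1)).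
Proof.
split.
- move=> [T P] /= [sT [sP wP]]; have [pT yam] := ssct_yam hmu sT.
  have /and3P[_ prt _] := sT.
  have [shP bP] := bounded_ssytP prt sP wP.
  split; rewrite /= ?size_map //; last first.
    by apply/funext => y; rewrite (pattern_of_weight bP) wP.
  split=> //=; [exact: size_pattern_of | exact: pattern_ofP bP m|].
  by move=> k; rewrite count_row_word // (top_pattern_of bP) -!nth_shape shP.
- move=> [T P] [T' P'] /set_mem /= [sT [sP wP]] /set_mem /= [sT' [sP' wP']] [eP eT].
  have /and3P[_ prt _] := sT; have /and3P[_ prt' _] := sT'.
  have [_ bP] := bounded_ssytP prt sP wP.
  have [_ bP'] := bounded_ssytP prt' sP' wP'.
  by congr (_, _); [apply: row_word_inj eT | apply: pattern_of_inj eP].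
move=> [p j] [/= [szp pat yam cnt] sz wt].
have [T sT jT] := row_word_surj hmu yam sz.
have [P bP pP] := pattern_of_surj szp pat.
exists (T, P); last by rewrite /= jT pP.
have [pT _] := ssct_yam hmu sT.
have /and3P[_ prt _] := sT; have [prtP sP _] := bP.
have shE : shape P = shape T.
  apply: part_ext => // k; rewrite !nth_shape -(top_pattern_of bP) pP -cnt -jT.
  by rewrite count_row_word.
split=> //=; split; first by rewrite -shE.
by apply/funext => y; rewrite -(pattern_of_weight bP) pP wt.
Qed.

(** Insertion preserves the descents of the word, so [maj] can be read off the recording word
    alone. *)
Lemma maj_rsk F : is_filling mu F -> weight F = alpha ->
  maj mu F = ascent_sum mu
    (fun q => nth 0 (rsk m (word mu F)).2 (index q (reading mu))).
Proof.
move=> fF wF; rewrite maj_ascent_sum //; apply: ascent_sum_words => // i hi.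
have bnd := word_bounds fF wF.
have [_ [_ sz _]] := rskP bnd; rewrite size_map in sz.
by rewrite (rsk_ascent bnd) ?size_map // map_nth_index ?reading_uniq.
Qed.

End Correspondence.

(** * Evaluation at q = 1 and the Schur expansion *)

Import GRing.Theory.
Local Open Scope ring_scope.

(** The outer indeterminate is q, so evaluating at 1 erases [inv] and keeps the power of t. *)
Lemma modified_macdonald_at1 (mu : seq nat) (alpha : nat -> nat) :
  (modified_macdonald mu alpha).[1] =
  \sum_(F \in [set F | is_filling mu F /\ weight F = alpha]%classic)
    ('X^(maj mu F) : {poly int}).
Proof.
have fin : finite_set [set F | is_filling mu F /\ weight F = alpha]%classic.
  apply: sub_finite_set (finite_fixed_weight mu alpha) => F [/andP[/eqP shF _] wF].
  by split.
rewrite /modified_macdonald !fsbig_finite // horner_sum; apply: eq_bigr => F _.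
by rewrite hornerM hornerXn expr1n mul1r hornerC.
Qed.

Lemma finite_ssyt (la : seq nat) (alpha : nat -> nat) :
  finite_set [set P | is_ssyt la P /\ weight P = alpha]%classic.
Proof.
apply: sub_finite_set (finite_fixed_weight la alpha).
by move=> P [/and3P[/andP[/eqP shP _] _ _] wP]; split.
Qed.

Theorem corollary33 (mu : seq nat) (hmu : is_part mu) (alpha : nat -> nat) :
  (modified_macdonald mu alpha).[1] =
  \sum_(T \in [set T | is_ssct mu T]%classic)
    'X^(cocharge mu T) * (schur (shape T) alpha)%:P :> {poly int}.
Proof.
rewrite modified_macdonald_at1.
(* The Schur coefficient counts tableaux [P], so the right-hand side becomes a sum over pairs
   [(T, P)]. *)
transitivity (\sum_(T \in [set T | is_ssct mu T]%classic)
    \sum_(P \in [set P | is_ssyt (shape T) P /\ weight P = alpha]%classic)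
      ('X^(cocharge mu T) : {poly int})); last first.
  apply: eq_fsbigr => T _; rewrite /schur !fsbig_finite; try exact: finite_ssyt.
  by rewrite rmorph_sum mulr_sumr; apply: eq_bigr => P _; rewrite rmorph1 mulr1.
rewrite fsbig_dep_pair /=; [|exact: finite_ssct|by move=> *; exact: finite_ssyt].
have [[m alpha0]|unbounded] := pselect (exists m, forall i, (m < i)%N -> alpha i = 0%N);
  last first.
  (* Weights have finite support, so for an unbounded [alpha] both index sets are empty. *)
  have no F : weight F = alpha -> False.
    by move=> wF; apply: unbounded; rewrite -wF; apply: weight_bounded.
  by rewrite !fsbig1 // => [[T P] [_ [_ /no]]|F [_ /no]].
(* Both sides are reindexed to the sum of this statistic over [rsk_pairs]; it depends only on the
   recording word. *)
pose stat (pj : seq (nat -> nat) * seq nat) : {poly int} :=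
  'X^(ascent_sum mu (fun q => nth 0%N pj.2 (index q (reading mu)))).
transitivity (\sum_(pj \in rsk_pairs mu alpha m) stat pj).
  rewrite (reindex_fsbig _ _ _ _ (filling_rsk_bij hmu alpha0)).
  by apply: eq_fsbigr => F /set_mem[fF wF]; rewrite (maj_rsk hmu alpha0).
rewrite (reindex_fsbig _ _ _ _ (ssct_ssyt_bij hmu alpha0)).
apply: eq_fsbigr => -[T P] /set_mem[/= sT _].
rewrite cocharge_ascent_sum // /stat /=; congr ('X^_).
apply: (ascent_sum_words hmu) => i _.
by rewrite map_nth_index ?reading_uniq // size_map.
Qed.
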